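(* For any signature $(r,s)$ there is a choice of distinct indices $1\le i_1,\dots,i_s\le n$ such that the affine chart ${}_1\mathcal U_{r,s}\subset\mathcal M$ is isomorphic to $\mathrm{Spec}\,O_F[D,Y]/I$, where $D=(d_{ij})$ is an $s\times s$ matrix of indeterminates, $Y=(y_{ij})$ is an $n\times s$ matrix of indeterminates, $Y'$ is the $s\times s$ submatrix of $Y$ formed by the rows $i_1,\dots,i_s$, $Q=\widetilde Y^{t}Y$, and \[ I=\big(Y'-I_s,\ D+D^t,\ D\cdot Q+2\pi I_s\big) \] (the ideal generated by the entries of these matrices).
   Context: Setting: $F_0$ complete discretely valued with ring of integers $O_{F_0}$, uniformizer $\pi_0$, perfect residue field $k$ of characteristic $\neq2$; $F/F_0$ ramified quadratic with ring of integers $O_F$, uniformizer $\pi$, $\pi^2=\pi_0$. $V$ an $F$-vector space of dimension $n=2m>3$ with split $F/F_0$-hermitian form $\phi$ ($\phi(e_i,e_{n+1-j})=\delta_{ij}$ for a basis $e_1,\dots,e_n$), $(x,y)=\frac12\mathrm{Tr}_{F/F_0}\phi(x,y)$. $\Lambda_m=\mathrm{span}_{O_F}\{\pi^{-1}e_1,\dots,\pi^{-1}e_m,e_{m+1},\dots,e_n\}$, $t$ = multiplication by $\pi$. Signature $r+s=n$, $s\le r$. $\mathcal M$ is the projective $O_F$-scheme representing $S\mapsto\{(\mathcal F_0,\mathcal F_1)\}$, $\mathcal F_0\subset\mathcal F_1\subset\Lambda_m\otimes_{O_{F_0}}\mathcal O_S$ $\mathcal O_S$-submodules, Zariski locally direct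 summands of ranks $s,n$, with $\mathcal F_1^\perp=\mathcal F_1$ for $(\,,\,)\otimes\mathcal O_S$, $(t+\pi)\mathcal F_1\subset\mathcal F_0$, $(t-\pi)\mathcal F_0=0$. Chart: let $f_1,\dots,f_{2n}$ be the $O_{F_0}$-basis $(\pi^{-1}e_1,\dots,\pi^{-1}e_m,e_{m+1},\dots,e_n,e_1,\dots,e_m,\pi e_{m+1},\dots,\pi e_n)$ of $\Lambda_m$. For distinct $1\le i_1,\dots,i_s\le n$, ${}_1\mathcal U_{r,s}$ is the open subscheme of $\mathcal M$ of points with: the projection $\Lambda_m\otimes\mathcal O_S\to\bigoplus_{j=n+1}^{2n}\mathcal O_Sf_j$ (with kernel spanned by $f_1,\dots,f_n$) restricts to an isomorphism on $\mathcal F_1$, and the map $\mathcal F_0\to\mathcal O_S^s$ given by the $f_{n+i_1},\dots,f_{n+i_s}$-coordinates is an isomorphism (an affine chart around points $(\mathcal F_0,t\Lambda_m\otimes k)$). $\widetilde Y$ is the $n\times s$ matrix whose $i$-th row is the $(n+1-i)$-th row of $Y$ for $1\le i\le m$ and minus the $(n+1-i)$-th row of $Y$ for $m+1\le i\le n$. *)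

(* Defs.v *)
From HB Require Import structures.
From mathcomp Require Import all_boot all_order all_algebra all_field.
From mathcomp Require Import boolp classical_sets mpoly.
From mathcomp Require Import zify.

Set Implicit Arguments.
Unset Strict Implicit.
Unset Printing Implicit Defensive.

Import Order.TTheory GRing.Theory Num.Theory passmx.
Local Open Scope classical_set_scope.
Local Open Scope ring_scope.

(* Normalised discrete valuations; the integer [dval v 0] carries no meaning. *)
Record discrete_valuation (K : fieldType) := DiscreteValuation {
  dval :> K -> int;
  dvalM : forall x y, x != 0 -> y != 0 -> dval (x * y) = dval x + dval y;
  dvalD : forall x y, x != 0 -> y != 0 -> x + y != 0 ->
    Num.min (dval x) (dval y) <= dval (x + y);
  dval_surj : exists2 x, x != 0 & dval x = 1 }.

Section Valuation.
Variables (K : fieldType) (v : discrete_valuation K).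

Definition val_ge (N : int) (x : K) : bool := (x == 0) || (N <= v x).

Definition complete_valuation : Prop :=
  forall u : nat -> K,
    (forall N : int, exists M : nat, forall i j : nat,
      (M <= i)%N -> (M <= j)%N -> val_ge N (u i - u j)) ->
    exists l : K, forall N : int, exists M : nat, forall i : nat,
      (M <= i)%N -> val_ge N (u i - l).

Definition uniformizer (x : K) : Prop := x != 0 /\ v x = 1.

Lemma dval1 : v 1 = 0.
Proof.
have := dvalM v (oner_neq0 K) (oner_neq0 K); rewrite mulr1 => /eqP.
by rewrite -subr_eq0 opprD addNKr oppr_eq0 => /eqP.
Qed.

Lemma dvalN1 : v (-1) = 0.
Proof.
have n1 : (-1 : K) != 0 by rewrite oppr_eq0 oner_neq0.
have := dvalM v n1 n1; rewrite mulrNN mulr1 dval1 => /esym/eqP.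
by rewrite -mulr2n mulrn_eq0 /= => /eqP.
Qed.

Lemma dvalN x : x != 0 -> v (- x) = v x.
Proof.
move=> x0; rewrite -mulN1r dvalM ?dvalN1 ?add0r//.
by rewrite oppr_eq0 oner_neq0.
Qed.

Lemma dvalD_lt x y : x != 0 -> y != 0 -> v x < v y ->
  x + y != 0 /\ v (x + y) = v x.
Proof.
move=> x0 y0 vxy.
have xy0 : x + y != 0.
  apply/eqP => /eqP; rewrite addr_eq0 => /eqP xE.
  by move: vxy; rewrite xE dvalN// ltxx.
split=> //; apply/eqP; rewrite eq_le; apply/andP; split.
  have := dvalD v xy0 (_ : - y != 0); rewrite oppr_eq0 => /(_ y0).
  by rewrite addrK => /(_ x0); rewrite dvalN// ge_min => /orP[//|]; rewrite leNgt vxy.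
by have := dvalD v x0 y0 xy0; rewrite ge_min => /orP[//|/(le_trans (ltW vxy))].
Qed.

Definition integral : {pred K} := [pred x | val_ge 0 x].

Lemma integral_subring_closed : subring_closed integral.
Proof.
split=> [|x y|x y].
- by rewrite inE /= /val_ge dval1 lexx orbT.
- rewrite !inE /= /val_ge.
  have [->|x0] := eqVneq x 0; have [->|y0] := eqVneq y 0 => //=.
  + by rewrite subr0 eqxx.
  + by rewrite sub0r oppr_eq0 (negPf y0) dvalN.
  + by rewrite subr0 (negPf x0).
  have [//|xy0] := eqVneq (x - y) 0; move=> vx vy /=.
  have Ny0 : - y != 0 by rewrite oppr_eq0.
  by apply: le_trans (dvalD v x0 Ny0 xy0); rewrite dvalN// le_min vx.
- rewrite !inE /= /val_ge mulf_eq0.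
  have [->|x0] := eqVneq x 0 => //=; have [->|y0] := eqVneq y 0 => //=.
  by move=> vx vy; rewrite dvalM// addr_ge0.
Qed.
HB.instance Definition _ :=
  GRing.isSubringClosed.Build K integral integral_subring_closed.

Record valring := ValRing { rval : K; rvalP : rval \in integral }.
HB.instance Definition _ := [isSub for rval].
HB.instance Definition _ := [Choice of valring by <:].
HB.instance Definition _ := [SubChoice_isSubComNzRing of valring by <:].

(* [k] is the residue field of [valring] through [res]. *)
Definition residue_map (k : fieldType) (res : {rmorphism valring -> k}) : Prop :=
  (forall y, exists x, res x = y) /\
  (forall x, res x = 0 <-> val_ge 1 (val x)).

End Valuation.

Definition perfect_field (k : fieldType) : Prop :=
  forall p : {poly k}, irreducible_poly p -> separable_poly p.

(* [v] is the normalised valuation of the quadratic extension [F], and extends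
   [v0] with ramification index 2. *)
Record ramified_quadratic (F0 : fieldType) (v0 : discrete_valuation F0)
    (F : fieldExtType F0) (v : discrete_valuation F) : Prop := {
  ramified_dim : \dim {:F} = 2%N;
  ramified_val : forall x : F0, x != 0 -> v x%:A = v0 x *+ 2 }.

Definition field_trace (F0 : fieldType) (F : fieldExtType F0) (x : F) : F0 :=
  \tr (mxof (vbasis {:F}) (vbasis {:F}) (amulr x)).

Section Submodules.
Variables (R : comPzRingType) (N : nat).
Implicit Types (M C : set 'rV[R]_N).

Definition submodule M : Prop :=
  M 0 /\ forall (a : R) x y, M x -> M y -> M (a *: x + y).

Definition direct_summand M : Prop :=
  submodule M /\ exists C, [/\ submodule C,
    forall x, exists y z, [/\ M y, C z & x = y + z] &
    forall x, M x -> C x -> x = 0].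

Definition free_of_rank (d : nat) M : Prop :=
  exists b : 'M[R]_(d, N),
    (forall x, M x <-> exists c : 'rV_d, x = c *m b) /\
    (forall c : 'rV_d, c *m b = 0 -> c = 0).

End Submodules.

Definition base_change (R R' : comPzRingType) (g : {rmorphism R -> R'}) (N : nat)
    (M : set 'rV[R]_N) : set 'rV[R']_N :=
  [set y | exists (l : nat) (c : 'rV[R']_l) (x : 'M[R]_(l, N)),
     (forall i, M (row i x)) /\ y = c *m map_mx g x].

Record is_localization (R R' : comPzRingType) (a : R)
    (g : {rmorphism R -> R'}) : Prop := {
  loc_unit : exists u, g a * u = 1;
  loc_frac : forall y, exists b k, y * g a ^+ k = g b;
  loc_ker : forall b, g b = 0 -> exists k, a ^+ k * b = 0 }.

(* Locally on the cover of Spec R by the basic opens D(a_i), the localisation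
   of [M] is a direct summand which is free of rank [d]. *)
Definition locally_direct_summand (R : comPzRingType) (N d : nat)
    (M : set 'rV[R]_N) : Prop :=
  submodule M /\
  exists (l : nat) (a : 'I_l -> R),
    (exists c : 'I_l -> R, \sum_i c i * a i = 1) /\
    forall i, exists (R' : comPzRingType) (g : {rmorphism R -> R'}),
      [/\ is_localization (a i) g, direct_summand (base_change g M)
        & free_of_rank d (base_change g M)].

Section Lattice.
Variables (F0 : fieldType) (v0 : discrete_valuation F0).
Variables (F : fieldExtType F0) (v : discrete_valuation F).
Hypothesis ramF : ramified_quadratic v0 v.
Local Notation O0 := (valring v0).
Local Notation O := (valring v).

Lemma base_integral (x : O0) : (val x)%:A \in integral v.
Proof.
case: x => x /=; rewrite !inE /= /val_ge => /orP[/eqP->|vx].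
  by rewrite scale0r eqxx.
have [->|x0] := eqVneq x 0; first by rewrite scale0r eqxx.
by rewrite (ramified_val ramF)// mulrn_wge0// orbT.
Qed.

Definition base_incl (x : O0) : O := ValRing (base_integral x).

Lemma base_incl_is_zmod_morphism : zmod_morphism base_incl.
Proof. by move=> x y; apply: val_inj; rewrite /= scalerBl. Qed.
Lemma base_incl_is_monoid_morphism : monoid_morphism base_incl.
Proof.
split; first by apply: val_inj; rewrite /= scale1r.
by move=> x y; apply: val_inj; rewrite /= -scalerAl mul1r scalerA.
Qed.
HB.instance Definition _ :=
  GRing.isZmodMorphism.Build O0 O base_incl base_incl_is_zmod_morphism.
HB.instance Definition _ :=
  GRing.isMonoidMorphism.Build O0 O base_incl base_incl_is_monoid_morphism.

Variables (V : vectType F) (n m : nat) (e : n.-tuple V) (pi : O).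

Definition fbasis (j : 'I_(n + n)) : V :=
  match split j with
  | inl i => if (i < m)%N then (val pi)^-1 *: tnth e i else tnth e i
  | inr i => if (i < m)%N then tnth e i else val pi *: tnth e i
  end.

Definition lattice : set V :=
  [set x | exists c : 'I_n -> O, x = \sum_i val (c i) *: fbasis (lshift n i)].

Definition lcomb (c : 'rV[O0]_(n + n)) : V :=
  \sum_j (val (c 0 j))%:A *: fbasis j.

(* Coordinates in the O_F0-basis [fbasis] of [lattice]; see [lcoordP]. *)
Definition lcoord (x : V) : 'rV[O0]_(n + n) := xget 0 [set c | x = lcomb c].

Definition tmx : 'M[O0]_(n + n) := \matrix_j lcoord (val pi *: fbasis j).

Variable phi : V -> V -> F.

Definition trform (x y : V) : F0 := 2%:R^-1 * field_trace (phi x y).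

(* The values [trform (fbasis j) (fbasis l)] are integral; see [gramE]. *)
Definition gram : 'M[O0]_(n + n) :=
  \matrix_(j, l) insubd (0 : O0) (trform (fbasis j) (fbasis l)).

(* For an O_F-algebra [rho : O -> R], the module [lattice] (x)_{O_F0} R is
   identified with 'rV[R]_(n + n) by means of the basis [fbasis]. *)
Section Points.
Variables (R : comPzRingType) (rho : {rmorphism O -> R}).
Local Notation rho0 := (fun a : O0 => rho (base_incl a)).

Definition tR (x : 'rV[R]_(n + n)) : 'rV[R]_(n + n) := x *m map_mx rho0 tmx.

Definition trformR (x y : 'rV[R]_(n + n)) : R :=
  (x *m map_mx rho0 gram *m y^T) 0 0.

Definition perp (F_1 : set 'rV[R]_(n + n)) : set 'rV[R]_(n + n) :=
  [set x | forall y, F_1 y -> trformR x y = 0].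

Record model_point (s : nat) (F_0 F_1 : set 'rV[R]_(n + n)) : Prop := {
  mp_summand0 : locally_direct_summand s F_0;
  mp_summand1 : locally_direct_summand n F_1;
  mp_sub : F_0 `<=` F_1;
  mp_perp : perp F_1 = F_1;
  mp_tDpi : forall x, F_1 x -> F_0 (tR x + rho pi *: x);
  mp_tBpi : forall x, F_0 x -> tR x - rho pi *: x = 0 }.

Record chart_point (s : nat) (idx : 'I_s -> 'I_n)
    (p : set 'rV[R]_(n + n) * set 'rV[R]_(n + n)) : Prop := {
  cp_point : model_point s p.1 p.2;
  cp_proj1 : forall b : 'rV[R]_n, exists! x, p.2 x /\ rsubmx x = b;
  cp_proj0 : forall b : 'rV[R]_s, exists! x,
    p.1 x /\ \row_k x 0 (rshift n (idx k)) = b }.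

End Points.
End Lattice.

Section RamifiedQuadratic.
Variables (F0 : fieldType) (v0 : discrete_valuation F0).
Variables (F : fieldExtType F0) (v : discrete_valuation F).
Hypothesis ramF : ramified_quadratic v0 v.
Variable pi : F.
Hypothesis pi_unif : uniformizer v pi.

Let pi_neq0 : pi != 0. Proof. by case: pi_unif. Qed.

Let scal_neq0 (a : F0) : (a%:A != 0 :> F) = (a != 0).
Proof. by rewrite scaler_eq0 oner_eq0 orbF. Qed.

Let val_scal_pi (b : F0) : b != 0 -> v (b%:A * pi) = v0 b *+ 2 + 1.
Proof. by move=> b0; rewrite dvalM ?scal_neq0// (ramified_val ramF)// pi_unif.2. Qed.

Lemma ramified_free (a b : F0) : a%:A + b%:A * pi = 0 -> a = 0 /\ b = 0.
Proof.
have [->|b0] := eqVneq b 0.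
  by rewrite scale0r mul0r addr0 => /eqP; rewrite scaler_eq0 oner_eq0 orbF => /eqP.
move=> /eqP; rewrite addr_eq0 => /eqP ab.
have [a0|a0] := eqVneq a 0.
  by move: ab => /eqP; rewrite a0 scale0r eq_sym oppr_eq0 mulf_eq0
    (negPf pi_neq0) orbF scaler_eq0 oner_eq0 orbF (negPf b0).
have := ramified_val ramF a0; rewrite ab dvalN ?val_scal_pi; first lia.
  by [].
by rewrite mulf_neq0 ?scal_neq0.
Qed.

Lemma ramified_span (x : F) : exists a b : F0, x = a%:A + b%:A * pi.
Proof.
have Xf : free [:: 1; pi].
  apply/freeP => c; rewrite !big_ord_recl big_ord0 /= addr0 => c0.
  have [] := @ramified_free (c ord0) (c (lift ord0 ord0)).
    by rewrite -scalerAl mul1r.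
  move=> c1 c2 i; have [->|->] // : i = ord0 \/ i = lift ord0 ord0.
  by case: i => [[|[|[]]]] // ?; [left|right]; apply: val_inj.
have Xb : basis_of {:F} [:: 1; pi].
  by rewrite basisEfree Xf subvf (ramified_dim ramF).
have := coord_basis (X := [tuple 1; pi]) Xb (memvf x).
rewrite !big_ord_recl big_ord0 /= addr0 => ->.
by eexists; eexists; rewrite -scalerAl mul1r.
Qed.

Lemma ramified_integral (x : valring v) : exists a b : valring v0,
  val x = (val a)%:A + (val b)%:A * pi.
Proof.
have [a [b xE]] := ramified_span (val x).
have [aI bI] : a \in integral v0 /\ b \in integral v0.
  have := valP x; rewrite xE !inE /= /val_ge.
  have [->|a0] := eqVneq a 0; have [->|b0] := eqVneq b 0 => //=.
  - rewrite scale0r add0r mulf_eq0 scaler_eq0 oner_eq0 (negPf b0).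
    by rewrite (negPf pi_neq0) val_scal_pi//=; split=> //; lia.
  - rewrite scale0r mul0r addr0 scaler_eq0 oner_eq0 (negPf a0) /=.
    by rewrite (ramified_val ramF)//; split=> //; lia.
  have A0 : a%:A != 0 :> F by rewrite scal_neq0.
  have B0 : b%:A * pi != 0 by rewrite mulf_neq0 ?scal_neq0.
  have [vab|vab|] := ltgtP (v a%:A) (v (b%:A * pi)).
  - have [/negPf-> ->] := dvalD_lt A0 B0 vab => /=.
    by move: vab; rewrite (ramified_val ramF)// val_scal_pi//; split; lia.
  - have [] := dvalD_lt B0 A0 vab; rewrite addrC => /negPf-> -> /=.
    by move: vab; rewrite (ramified_val ramF)// val_scal_pi//; split; lia.
  by rewrite (ramified_val ramF)// val_scal_pi//; lia.
by exists (ValRing aI), (ValRing bI).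
Qed.

Section LatticeBasis.
Variables (V : vectType F) (n m : nat) (e : n.-tuple V).
Hypothesis e_basis : basis_of {:V} e.
Variable piO : valring v.
Hypothesis piOE : val piO = pi.

Lemma fbasis_rshift i :
  fbasis m e piO (rshift n i) = val piO *: fbasis m e piO (lshift n i).
Proof.
rewrite /fbasis (unsplitK (inl i)) (unsplitK (inr i)).
by case: ifP; rewrite ?scalerA ?divff ?scale1r ?piOE.
Qed.

Lemma lcombE (c : 'rV[valring v0]_(n + n)) :
  lcomb m e piO c = \sum_i
    ((val (c 0 (lshift n i)))%:A + (val (c 0 (rshift n i)))%:A * pi)
      *: fbasis m e piO (lshift n i).
Proof.
rewrite /lcomb big_split_ord /= -big_split /=; apply: eq_bigr => i _.
by rewrite fbasis_rshift piOE scalerA scalerDl.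
Qed.

(* [fbasis] is a basis of [lattice] over the ring of integers of [F0]. *)
Lemma lattice_basisP (x : V) :
  lattice m e piO x <-> exists! c : 'rV[valring v0]_(n + n), x = lcomb m e piO c.
Proof.
split=> [[c xE]|[c [->] _]]; last first.
  exists (fun i => base_incl ramF (c 0 (lshift n i))
                   + base_incl ramF (c 0 (rshift n i)) * piO).
  by rewrite lcombE; apply: eq_bigr => i _; rewrite /= piOE.
have /choice[ab abE] : forall i, exists ab : valring v0 * valring v0,
    val (c i) = (val ab.1)%:A + (val ab.2)%:A * pi.
  by move=> i; have [a [b ?]] := ramified_integral (c i); exists (a, b).
pose d := row_mx (\row_i (ab i).1) (\row_i (ab i).2).
exists d; have xd : x = lcomb m e piO d.
  rewrite xE lcombE; apply: eq_bigr => i _.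
  by rewrite row_mxEl row_mxEr !mxE abE.
split=> // d'; rewrite xd !lcombE => /eqP; rewrite -subr_eq0 -sumrB => /eqP dd'.
pose u i := if (i < m)%N then pi^-1 else 1.
have u0 i : u i != 0 by rewrite /u; case: ifP; rewrite ?invr_eq0 ?oner_eq0.
have fu i : fbasis m e piO (lshift n i) = u i *: e`_i.
  rewrite /fbasis (unsplitK (inl i)) (tnth_nth 0) /u piOE.
  by case: ifP; rewrite ?scale1r.
have key i : let D c := (val (c 0 (lshift n i)))%:A
    + (val (c 0 (rshift n i)))%:A * pi in D d - D d' = 0.
  move: dd' => /=; under eq_bigr => j _ do rewrite -scalerBl fu scalerA.
  move: (basis_free e_basis) => /freeP fr /fr/(_ i)/eqP.
  by rewrite mulf_eq0 (negPf (u0 i)) orbF => /eqP.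
apply/rowP => j.
have key2 i : d 0 (lshift n i) = d' 0 (lshift n i)
    /\ d 0 (rshift n i) = d' 0 (rshift n i).
  have /= := key i; rewrite opprD addrACA -scalerBl -mulrBl -scalerBl.
  move=> /ramified_free[/eqP + /eqP]; rewrite !subr_eq0.
  by move=> /eqP/val_inj-> /eqP/val_inj->.
by rewrite -(splitK j); case: (split j) => i /=; case: (key2 i).
Qed.

Lemma lcoordP (x : V) :
  lattice m e piO x -> lcomb m e piO (lcoord v0 m e piO x) = x.
Proof.
move=> /lattice_basisP[c [xc _]].
by rewrite /lcoord; case: xgetP => [y _ /= <-|/(_ c)].
Qed.

End LatticeBasis.

Section Trace.
Variable sigma : {rmorphism F -> F}.
Hypothesis sigma_F0 : forall a : F0, sigma a%:A = a%:A.
Hypothesis sigma_nontriv : exists x, sigma x != x.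
Variable pi0 : F0.
Hypothesis pi_sq : pi ^+ 2 = pi0%:A.
Hypothesis F0_char : (2%:R : F0) != 0.

Lemma conj_pi : sigma pi = - pi.
Proof.
have /eqP : (sigma pi) ^+ 2 = pi ^+ 2 by rewrite -rmorphXn pi_sq sigma_F0.
rewrite eqf_sqr => /orP[/eqP spi|/eqP//].
have [x /eqP[]] := sigma_nontriv; have [a [b ->]] := ramified_span x.
by rewrite rmorphD rmorphM !sigma_F0 spi.
Qed.

Lemma field_trace_is_linear : scalar (@field_trace F0 F).
Proof.
move=> a x y; rewrite /field_trace.
have -> : amulr (a *: x + y) = a *: amulr x + amulr y.
  by apply/lfunP => z; rewrite add_lfunE scale_lfunE !lfunE /= mulrDr scalerAr.
by rewrite linearP /= linearD linearZ.
Qed.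
HB.instance Definition _ := GRing.isSemilinear.Build F0 F F0 *%R
  (@field_trace F0 F) (GRing.semilinear_linear field_trace_is_linear).

Lemma field_trace_pi : field_trace pi = 0.
Proof.
pose M := mxof (vbasis {:F}) (vbasis {:F}).
have sL : linear sigma.
  by move=> a x y; rewrite rmorphD -mulr_algl rmorphM sigma_F0 mulr_algl.
pose sl : {linear F -> F} := HB.pack (sigma : F -> F) (GRing.isLinear.Build _ _ _ _ (sigma : F -> F) sL).
pose S := linfun sl.
have Mcomp (f g : 'End(F)) : M (g \o f)%VF = M f *m M g.
  by apply: mxof_comp; exact: vbasisP.
have SE x : S x = sigma x by rewrite lfunE.
have sK : sigma \o sigma =1 id.
  move=> x; have [a [b ->]] := ramified_span x.
  by rewrite /= !(rmorphD, rmorphM, sigma_F0, conj_pi, rmorphN) opprK.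
have SS : (S \o S)%VF = \1%VF.
  by apply/lfunP => x; rewrite comp_lfunE !SE id_lfunE; exact: sK.
have SpS : (S \o amulr pi \o S)%VF = - amulr pi.
  apply/lfunP => x; rewrite opp_lfunE !comp_lfunE !SE !lfunE /= rmorphM.
  by rewrite [sigma (sigma x)]sK conj_pi mulrN.
have : \tr (M (S \o amulr pi \o S)%VF) = field_trace pi.
  by rewrite Mcomp Mcomp mxtrace_mulC -mulmxA -Mcomp SS -Mcomp comp_lfun1l.
rewrite SpS /M linearN linearN /= => /eqP; rewrite -/(field_trace pi).
rewrite eq_sym -addr_eq0 -mulr2n -mulr_natl mulf_eq0 (negPf F0_char) /=.
by move/eqP.
Qed.

Lemma field_trace_scal (a : F0) : field_trace (a%:A : F) = a *+ 2.
Proof.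
rewrite linearZ /= /field_trace.
have -> : amulr (1 : F) = \1%VF by apply/lfunP => x; rewrite !lfunE /= mulr1.
have -> : mxof (vbasis {:F}) (vbasis {:F}) \1%VF = 1%:M.
  by apply: mxof1; apply: basis_free (vbasisP _).
by rewrite mxtrace1 (ramified_dim ramF) mulr_natr.
Qed.

Lemma half_trace (a b : F0) :
  2%:R^-1 * field_trace (a%:A + b%:A * pi) = a.
Proof.
rewrite linearD /= field_trace_scal -scalerAl mul1r linearZ /= field_trace_pi.
by rewrite mulr0 addr0 -(mulr_natl a) mulrA mulVf ?mul1r.
Qed.


Section FormValues.
Variables (V : vectType F) (phi : {hermitian V for false & sigma}).
Variables (n m : nat) (e : n.-tuple V) (piO : valring v).
Hypothesis n_even : n = (2 * m)%N.
Hypothesis phi_split : forall i j : 'I_n,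
  phi (tnth e i) (tnth e (rev_ord j)) = (i == j)%:R.
Hypothesis piOE : val piO = pi.

(* The form is integral on [lattice]: [insubd] in [gram] never defaults. *)
Lemma gramE j l :
  val (gram v0 m e piO phi j l)
    = trform phi (fbasis m e piO j) (fbasis m e piO l).
Proof.
rewrite mxE val_insubd ifT// /trform.
pose I (x : F) := exists a b, x = (a%:~R : F0)%:A + b%:A * pi.
suff [a [b ->]] : I (phi (fbasis m e piO j) (fbasis m e piO l)).
  by rewrite half_trace rpred_int.
have I0 : I 0 by exists 0, 0; rewrite !scale0r mul0r addr0.
have I1 : I 1 by exists 1, 0; rewrite scale1r scale0r mul0r addr0.
have IN x : I x -> I (- x).
  move=> [a [b ->]]; exists (- a), (- b).
  by rewrite opprD rmorphN !scaleNr mulNr.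
have Ipi : I pi by exists 0, 1; rewrite !scale0r scale1r mul1r add0r.
have IpiV : I pi^-1.
  exists 0, pi0^-1; rewrite scale0r add0r -scalerAl mul1r.
  have pi00 : pi0 != 0.
    apply/eqP => pi00; move/eqP: pi_sq.
    by rewrite pi00 scale0r expf_eq0 /= (negPf pi_neq0).
  apply: (mulfI pi_neq0); rewrite divff// -scalerAr -expr2 pi_sq scalerA.
  by rewrite mulVf// scale1r.
have phiE (i i' : 'I_n) : phi (tnth e i) (tnth e i') = (i == rev_ord i')%:R.
  by rewrite -phi_split rev_ordK.
have Z1 a x y : phi (a *: x) y = a * phi x y by rewrite linearZl_LR.
have Z2 a x y : phi x (a *: y) = sigma a * phi x y by rewrite linearZr_LR.
have revm (i i' : 'I_n) : i = rev_ord i' -> (i < m)%N = ~~ (i' < m)%N.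
  by move=> ->; have := ltn_ord i'; rewrite /= {2}n_even; lia.
have spi : sigma pi = - pi := conj_pi.
have spiV : sigma pi^-1 = - pi^-1 by rewrite fmorphV spi invrN.
rewrite /fbasis piOE.
have I_ x y (i i' : 'I_n) : ((i < m)%N = ~~ (i' < m)%N -> I (x * sigma y)) ->
    I (phi (x *: tnth e i) (y *: tnth e i')).
  move=> Ixy; rewrite Z1 Z2 phiE; case: eqP => [/revm/Ixy|_].
    by rewrite mulr1.
  by rewrite !mulr0.
have I_l x (i i' : 'I_n) : ((i < m)%N = ~~ (i' < m)%N -> I x) ->
    I (phi (x *: tnth e i) (tnth e i')).
  by move=> Ix; rewrite -[tnth e i']scale1r; apply: I_; rewrite rmorph1 mulr1.
have I_r y (i i' : 'I_n) : ((i < m)%N = ~~ (i' < m)%N -> I (sigma y)) ->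
    I (phi (tnth e i) (y *: tnth e i')).
  by move=> Iy; rewrite -[tnth e i]scale1r; apply: I_; rewrite mul1r.
case: (split j) => i; case: (split l) => i';
  case: ifP => im; case: ifP => im';
  (apply: I_ || apply: I_l || apply: I_r || (rewrite phiE; case: eqP => _ //));
  rewrite ?im ?im' //= => _;
  rewrite ?spi ?spiV ?mulrN ?divff ?mulVf//; auto.
Qed.

End FormValues.
End Trace.

End RamifiedQuadratic.

Section IdealQuotient.
Variables (R : comPzRingType) (G : set R).

Definition gen_ideal : {pred R} := [pred x | `[<
  exists (l : nat) (a g : 'I_l -> R),
    (forall i, G (g i)) /\ x = \sum_i a i * g i >]].

Lemma gen_idealMD a x y :
  x \in gen_ideal -> y \in gen_ideal -> a * x + y \in gen_ideal.
Proof.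
move=> /asboolP[l [b [g [Gg ->]]]] /asboolP[l' [b' [g' [Gg' ->]]]].
apply/asboolP; exists (l + l')%N.
exists (fun i => match split i with inl j => a * b j | inr j => b' j end).
exists (fun i => match split i with inl j => g j | inr j => g' j end).
split=> [i|]; first by case: (split i).
rewrite big_split_ord /= mulr_sumr; congr (_ + _); apply: eq_bigr => i _.
  by rewrite (unsplitK (inl i)) mulrA.
by rewrite (unsplitK (inr i)).
Qed.

Lemma gen_ideal0 : 0 \in gen_ideal.
Proof.
by apply/asboolP; exists 0%N, (fun=> 0), (fun=> 0); split=> [[]|]//; rewrite big_ord0.
Qed.

Lemma gen_idealM a x : x \in gen_ideal -> a * x \in gen_ideal.
Proof. by move=> /(gen_idealMD a)/(_ gen_ideal0); rewrite addr0. Qed.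

Lemma gen_ideal_zmod_closed : zmod_closed gen_ideal.
Proof.
split=> [|x y xI yI]; first exact: gen_ideal0.
by rewrite addrC -mulN1r; exact: gen_idealMD.
Qed.
HB.instance Definition _ :=
  GRing.isZmodClosed.Build R gen_ideal gen_ideal_zmod_closed.

(* The library's ring structure on quotients requires a proper ideal, which
   is why the (possibly zero) ring structure is put here on the additive
   quotient. *)
Definition gen_quot := {ideal_quot gen_ideal}.
HB.instance Definition _ := GRing.Zmodule.on gen_quot.

Local Open Scope quotient_scope.

Definition gq_proj (x : R) : gen_quot := \pi_({ideal_quot gen_ideal}) x.
Definition gq_mul (x y : gen_quot) : gen_quot :=
  gq_proj (repr (x : {ideal_quot gen_ideal}) * repr (y : {ideal_quot gen_ideal})).

Lemma gq_projP x y : gq_proj x = gq_proj y <-> x - y \in gen_ideal.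
Proof. by rewrite Quotient.idealrBE; split=> /eqP. Qed.

Lemma gq_proj_surj (x : gen_quot) : exists y, x = gq_proj y.
Proof. by exists (repr (x : {ideal_quot gen_ideal})); rewrite /gq_proj reprK. Qed.

Lemma gq_projM x y : gq_proj (x * y) = gq_mul (gq_proj x) (gq_proj y).
Proof.
rewrite /gq_mul; set x' := repr _; set y' := repr _.
have hx : x - x' \in gen_ideal by apply/gq_projP; rewrite /gq_proj reprK.
have hy : y - y' \in gen_ideal by apply/gq_projP; rewrite /gq_proj reprK.
apply/gq_projP.
have -> : x * y - x' * y' = y * (x - x') + x' * (y - y').
  by rewrite !mulrBr addrA [y * x]mulrC [y * x']mulrC subrK.
by apply: gen_idealMD => //; exact: gen_idealM.
Qed.

Lemma gq_projD x y : gq_proj (x + y) = gq_proj x + gq_proj y.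
Proof. exact: raddfD. Qed.

Lemma gq_mulA : associative gq_mul.
Proof.
move=> x y z; have [x' ->] := gq_proj_surj x.
have [y' ->] := gq_proj_surj y; have [z' ->] := gq_proj_surj z.
by rewrite -!gq_projM mulrA.
Qed.

Lemma gq_mulC : commutative gq_mul.
Proof. by move=> x y; rewrite /gq_mul mulrC. Qed.

Lemma gq_mul1 : left_id (gq_proj 1) gq_mul.
Proof. by move=> x; have [x' ->] := gq_proj_surj x; rewrite -gq_projM mul1r. Qed.

Lemma gq_mulDl : left_distributive gq_mul +%R.
Proof.
move=> x y z; have [x' ->] := gq_proj_surj x.
have [y' ->] := gq_proj_surj y; have [z' ->] := gq_proj_surj z.
by rewrite -gq_projD -!gq_projM mulrDl gq_projD.
Qed.

HB.instance Definition _ := GRing.Zmodule_isComPzRing.Build gen_quot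
  gq_mulA gq_mulC gq_mul1 gq_mulDl.

Lemma gq_proj_is_zmod_morphism : zmod_morphism gq_proj.
Proof. exact: raddfB. Qed.
Lemma gq_proj_is_monoid_morphism : monoid_morphism gq_proj.
Proof. by split=> // x y; exact: gq_projM. Qed.
HB.instance Definition _ :=
  GRing.isZmodMorphism.Build R gen_quot gq_proj gq_proj_is_zmod_morphism.
HB.instance Definition _ :=
  GRing.isMonoidMorphism.Build R gen_quot gq_proj gq_proj_is_monoid_morphism.

End IdealQuotient.

Section ChartRing.
Variables (O : comNzRingType) (pi : O) (n m s : nat) (idx : 'I_s -> 'I_n).

Definition DYring : comNzRingType := {mpoly O[s * s + n * s]}.

Definition Dmx : 'M[DYring]_s :=
  \matrix_(i, j) 'X_(lshift (n * s) (mxvec_index i j)).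

Definition Ymx : 'M[DYring]_(n, s) :=
  \matrix_(i, j) 'X_(rshift (s * s) (mxvec_index i j)).

Definition tilde (R : pzRingType) (Y : 'M[R]_(n, s)) : 'M[R]_(n, s) :=
  \matrix_(i, j) if (i < m)%N then Y (rev_ord i) j else - Y (rev_ord i) j.

Definition Qmx : 'M[DYring]_s := (tilde Ymx)^T *m Ymx.

Definition mx_entries (p q : nat) (A : 'M[DYring]_(p, q)) : set DYring :=
  [set x | exists i j, x = A i j].

Definition chart_relations : set DYring :=
  mx_entries (rowsub idx Ymx - 1%:M)
  `|` mx_entries (Dmx + Dmx^T)
  `|` mx_entries (Dmx *m Qmx + (2%:R * pi)%:MP%:M).

Definition chart_ring : comPzRingType := gen_quot chart_relations.

Definition chart_ring_str (c : O) : chart_ring :=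
  gq_proj chart_relations (c%:MP : DYring).

Lemma chart_ring_str_is_zmod_morphism : zmod_morphism chart_ring_str.
Proof. by move=> x y; rewrite /chart_ring_str mpolyCB rmorphB. Qed.
Lemma chart_ring_str_is_monoid_morphism : monoid_morphism chart_ring_str.
Proof.
split; first by rewrite /chart_ring_str mpolyC1 rmorph1.
by move=> x y; rewrite /chart_ring_str mpolyCM rmorphM.
Qed.
HB.instance Definition _ := GRing.isZmodMorphism.Build O chart_ring
  chart_ring_str chart_ring_str_is_zmod_morphism.
HB.instance Definition _ := GRing.isMonoidMorphism.Build O chart_ring
  chart_ring_str chart_ring_str_is_monoid_morphism.

End ChartRing.

Record alg_hom (O A R : comPzRingType) (alpha : O -> A) (rho : O -> R) := AlgHom {
  ahom :> {rmorphism A -> R};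
  ahomE : forall c, ahom (alpha c) = rho c }.

(* The O-scheme with functor of points R |-> {p : T R | P R p}, where [T] is
   functorial by [Tmap], is isomorphic over O to Spec A, the scheme with functor
   of points R |-> Hom_O(A, R). *)
Definition iso_Spec (O A : comPzRingType) (alpha : {rmorphism O -> A})
    (T : comPzRingType -> Type)
    (Tmap : forall R R' : comPzRingType, {rmorphism R -> R'} -> T R -> T R')
    (P : forall R : comPzRingType, {rmorphism O -> R} -> T R -> Prop) : Prop :=
  exists Phi : forall (R : comPzRingType) (rho : {rmorphism O -> R}),
      alg_hom alpha rho -> T R,
  [/\ (forall (R : comPzRingType) (rho : {rmorphism O -> R}) (h : alg_hom alpha rho),
         P R rho (Phi R rho h)),
      (forall (R : comPzRingType) (rho : {rmorphism O -> R}) (h h' : alg_hom alpha rho),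
         Phi R rho h = Phi R rho h' -> h =1 h'),
      (forall (R : comPzRingType) (rho : {rmorphism O -> R}) (p : T R), P R rho p ->
         exists h : alg_hom alpha rho, Phi R rho h = p)
    & (forall (R R' : comPzRingType) (rho : {rmorphism O -> R}) (rho' : {rmorphism O -> R'})
         (g : {rmorphism R -> R'}) (h : alg_hom alpha rho) (h' : alg_hom alpha rho'),
         g \o rho =1 rho' -> h' =1 g \o h ->
         Phi R' rho' h' = Tmap R R' g (Phi R rho h))].

Arguments iso_Spec {O A} alpha T Tmap P.

Definition pair_base_change (N : nat) (R R' : comPzRingType)
    (g : {rmorphism R -> R'}) (p : set 'rV[R]_N * set 'rV[R]_N) :=
  (base_change g p.1, base_change g p.2).

(* Main.v *)
Require Import Defs.
From HB Require Import structures.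
From mathcomp Require Import all_boot all_order all_algebra all_field.
From mathcomp Require Import boolp classical_sets mpoly.
From mathcomp Require Import zify.

(* In the basis [fbasis], with row vectors split as (u, w), the operator t is
   (u, w) |-> (pi0 w, u), and the form is w J u'^t - u J w'^t, where the signed
   reversal matrix J satisfies J^t = - J, J^t J = 1 and J Y = [tilde m Y].
   On the chart, F_1 is the graph {(w X, w)} of an n x n matrix X, and F_0 is
   spanned by the rows of (pi Y^t, Y^t), where Y is normalised by Y' = 1.  The
   condition (t + pi) F_1 <= F_0 says X + pi = A Y^t, with A the columns idx of
   X + pi.  Then F_1^perp = F_1 means that A Y^t J is antisymmetric, which forces
   A = (tilde Y) D for a unique D, with D + D^t = 0; and F_0 <= F_1 becomes
   Y^t A = 2 pi, the transpose of D Q + 2 pi = 0.  Any injective choice of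
   indices works. *)

Set Implicit Arguments.
Unset Strict Implicit.
Unset Printing Implicit Defensive.

Import GRing.Theory.
Local Open Scope classical_set_scope.
Local Open Scope ring_scope.

(** * Free direct summands as row spaces of normalised matrices *)

Section RowSpace.
Variable R : comPzRingType.

Definition rowspace (d N : nat) (B : 'M[R]_(d, N)) : set 'rV[R]_N :=
  [set x | exists c : 'rV_d, x = c *m B].

Lemma rowspace_mul d N (B : 'M[R]_(d, N)) c : rowspace B (c *m B).
Proof. by exists c. Qed.

Lemma rowspace_row d N (B : 'M[R]_(d, N)) i : rowspace B (row i B).
Proof. by exists (delta_mx 0 i); rewrite -rowE. Qed.

Lemma rowspace_submodule d N (B : 'M[R]_(d, N)) : submodule (rowspace B).
Proof.
split; first by exists 0; rewrite mul0mx.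
by move=> a _ _ [c ->] [c' ->]; exists (a *: c + c'); rewrite mulmxDl scalemxAl.
Qed.

Lemma submodule_mulmx d N (M : set 'rV[R]_N) (B : 'M[R]_(d, N)) (c : 'rV_d) :
  submodule M -> (forall i, M (row i B)) -> M (c *m B).
Proof.
move=> [M0 MD] MB; rewrite mulmx_sum_row.
by elim/big_rec: _ => // i x _ Mx; exact: MD.
Qed.

Lemma mem_rowspace_colsub d N (f : 'I_d -> 'I_N) (B : 'M[R]_(d, N)) x :
  colsub f B = 1%:M -> rowspace B x -> x = colsub f x *m B.
Proof. by move=> fB [c ->]; rewrite -mulmx_colsub fB mulmx1. Qed.

(** The entries of a vector at the columns [f] are its coefficients on the rows of [B']. Row [i] of
    [B] has the [i]-th unit vector there, so it is row [i] of [B']. *)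
Lemma rowspace_colsub_inj d N (f : 'I_d -> 'I_N) (B B' : 'M[R]_(d, N)) :
  colsub f B = 1%:M -> colsub f B' = 1%:M -> rowspace B = rowspace B' -> B = B'.
Proof.
move=> fB fB' BB'; apply/row_matrixP => i.
have := rowspace_row B i; rewrite BB' => /(mem_rowspace_colsub fB') ->.
by rewrite {1}rowE -mulmx_colsub fB mulmx1 -rowE.
Qed.

Lemma rowspace_uniq_lift d N (f : 'I_d -> 'I_N) (g : 'rV[R]_N -> 'rV_d)
    (B : 'M[R]_(d, N)) :
  g =1 colsub f -> colsub f B = 1%:M ->
  forall b : 'rV_d, exists! x, rowspace B x /\ g x = b.
Proof.
move=> gE fB b; exists (b *m B); split.
  by split; [exact: rowspace_mul | rewrite gE -mulmx_colsub fB mulmx1].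
move=> x [/(mem_rowspace_colsub fB) -> <-].
by rewrite gE -mulmx_colsub fB mulmx1.
Qed.

(** The rows of [B] are the lifts of the unit vectors. A vector of [M] and the combination of these
    rows with the same [f]-coordinates lift the same element, so uniqueness identifies them. The map
    [g] is kept apart from [colsub f] because the two projections of [chart_point] are written
    differently. *)
Lemma uniq_lift_rowspace d N (f : 'I_d -> 'I_N) (g : 'rV[R]_N -> 'rV_d)
    (M : set 'rV[R]_N) :
  g =1 colsub f -> submodule M -> (forall b : 'rV_d, exists! x, M x /\ g x = b) ->
  exists2 B : 'M[R]_(d, N), colsub f B = 1%:M & M = rowspace B.
Proof.
move=> gE sM Mf.
have /choice[h hP] : forall b : 'rV_d, exists x, M x /\ colsub f x = b.
  by move=> b; have [x []] := Mf b; rewrite gE; exists x.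
pose B := \matrix_i h (delta_mx 0 i).
have MB i : M (row i B) by rewrite rowK; have [] := hP (delta_mx 0 i).
have fB : colsub f B = 1%:M.
  apply/row_matrixP => i; rewrite row1; have [_ <-] := hP (delta_mx 0 i).
  by apply/rowP => j; rewrite !mxE.
exists B => //; apply/seteqP; split=> x /= => [Mx|[c ->]]; last exact: submodule_mulmx.
exists (colsub f x); have [y [_ y_uniq]] := Mf (g x).
rewrite -{1}(y_uniq x (conj Mx erefl)); apply: y_uniq.
split; first exact: submodule_mulmx.
by rewrite !gE -mulmx_colsub fB mulmx1.
Qed.

(** The map sending [x] to [colsub f x *m B] is a projector onto the row space; the complement is
    its kernel, the vectors vanishing at the columns [f]. *)
Lemma rowspace_summand d N (f : 'I_d -> 'I_N) (B : 'M[R]_(d, N)) :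
  colsub f B = 1%:M -> direct_summand (rowspace B) /\ free_of_rank d (rowspace B).
Proof.
move=> fB; split; last first.
  exists B; split=> // c cB; rewrite -[c]mulmx1 -fB mulmx_colsub cB.
  by rewrite linear0.
split; first exact: rowspace_submodule.
exists [set x | colsub f x = 0]; split.
- split=> [|a x y /= fx fy]; first exact: linear0.
  by rewrite linearP /= fx fy scaler0 addr0.
- move=> x; exists (colsub f x *m B), (x - colsub f x *m B); split=> /=.
  + exact: rowspace_mul.
  + by rewrite linearB /= -mulmx_colsub fB mulmx1 subrr.
  + by rewrite addrC subrK.
- by move=> x /(mem_rowspace_colsub fB) xE /= fx; rewrite xE fx mul0mx.
Qed.

End RowSpace.

Lemma base_change_rowspace (R R' : comPzRingType) (g : {rmorphism R -> R'})
    (d N : nat) (B : 'M[R]_(d, N)) :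
  base_change g (rowspace B) = rowspace (map_mx g B).
Proof.
apply/seteqP; split=> y /=.
  move=> [l [c [x [/choice[a xE] ->]]]]; exists (c *m map_mx g (\matrix_i a i)).
  rewrite -mulmxA -map_mxM; congr (_ *m map_mx g _).
  by apply/row_matrixP => i; rewrite row_mul rowK.
by move=> [c ->]; exists d, c, B; split=> // i; exact: rowspace_row.
Qed.

(** A normalised row space is a free summand globally, so the cover by the single open D(1) is
    enough, with the identity of [R] as localisation. *)
Lemma rowspace_locally_direct_summand (R : comPzRingType) (d N : nat)
    (f : 'I_d -> 'I_N) (B : 'M[R]_(d, N)) :
  colsub f B = 1%:M -> locally_direct_summand d (rowspace B).
Proof.
move=> fB; split; first exact: rowspace_submodule.
exists 1%N, (fun=> 1); split; first by exists (fun=> 1); rewrite big_ord1 mulr1.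
move=> i; exists R, (idfun : {rmorphism R -> R}).
rewrite base_change_rowspace map_mx_id//; have [? ?] := rowspace_summand fB.
split=> //; split.
- by exists 1; rewrite /= mulr1.
- by move=> y; exists y, 0%N; rewrite expr0 mulr1.
- by move=> b /= b0; exists 0%N; rewrite expr0 mul1r.
Qed.

(** * Homomorphisms out of quotients and polynomial rings *)

Section QuotientMorphism.
Variables (A S : comPzRingType) (G : set A) (f : {rmorphism A -> S}).
Hypothesis fG : forall x, G x -> f x = 0.

Lemma gen_ideal_ker x : x \in gen_ideal G -> f x = 0.
Proof.
move=> /asboolP[l [a [g [Gg ->]]]]; rewrite rmorph_sum big1// => i _.
by rewrite rmorphM (fG (Gg i)) mulr0.
Qed.

(** Universal property of the quotient: [f] is evaluated on chosen representatives, and the choice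
    is harmless because [f] kills the ideal. *)
Lemma gq_lift : exists h : {rmorphism gen_quot G -> S},
  forall x, h (gq_proj G x) = f x.
Proof.
pose h (x : gen_quot G) := f (repr (x : {ideal_quot gen_ideal G})).
have hE x : h (gq_proj G x) = f x.
  apply/eqP; rewrite -subr_eq0 -rmorphB; apply/eqP/gen_ideal_ker/gq_projP.
  by rewrite /gq_proj reprK.
have hB : zmod_morphism h.
  move=> x y; have [x' ->] := gq_proj_surj x; have [y' ->] := gq_proj_surj y.
  by rewrite -rmorphB !hE rmorphB.
have hM : monoid_morphism h.
  split=> [|x y]; first by rewrite -(rmorph1 (gq_proj G)) hE rmorph1.
  have [x' ->] := gq_proj_surj x; have [y' ->] := gq_proj_surj y.
  by rewrite -rmorphM !hE rmorphM.
pose H : {rmorphism gen_quot G -> S} := HB.pack h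
  (GRing.isZmodMorphism.Build _ _ h hB) (GRing.isMonoidMorphism.Build _ _ h hM).
by exists H.
Qed.

End QuotientMorphism.

Section PolynomialMorphism.
Variables (O : comNzRingType) (N : nat) (R : comPzRingType).

(* The zero ring is treated apart, as [mmap] needs a nontrivial target. *)
Lemma mpoly_eval (rho : {rmorphism O -> R}) (w : 'I_N -> R) :
  exists h : {rmorphism {mpoly O[N]} -> R},
    (forall c, h c%:MP = rho c) /\ forall i, h 'X_i = w i.
Proof.
have [R0|R1] := eqVneq (1 : R) 0.
  have triv (x y : R) : x = y by rewrite -[x]mul1r -[y]mul1r R0 !mul0r.
  pose z (_ : {mpoly O[N]}) : R := 0.
  have zB : zmod_morphism z by move=> ? ?; exact: triv.
  have zM : monoid_morphism z by split=> [|? ?]; exact: triv.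
  pose h : {rmorphism {mpoly O[N]} -> R} := HB.pack z
    (GRing.isZmodMorphism.Build _ _ z zB) (GRing.isMonoidMorphism.Build _ _ z zM).
  by exists h; split=> *; exact: triv.
pose S : comNzRingType := HB.pack (GRing.ComPzRing.sort R) (GRing.PzSemiRing_isNonZero.Build R R1).
pose rhoS : {rmorphism O -> S} := rho.
pose h : {rmorphism {mpoly O[N]} -> S} := mmap rhoS w.
exists (h : {rmorphism {mpoly O[N]} -> R}); split=> [c|i].
  exact: (@mmapC N O S w rhoS).
exact: etrans (@mmapX N O S w rhoS _) (@mmap1U _ S _ _).
Qed.

Lemma mpoly_rmorphism_ext (h h' : {rmorphism {mpoly O[N]} -> R}) :
  (forall c, h c%:MP = h' c%:MP) -> (forall i, h 'X_i = h' 'X_i) -> h =1 h'.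
Proof.
move=> hC hX p; rewrite [p]mpolyE !rmorph_sum; apply: eq_bigr => m _ /=.
rewrite -mul_mpolyC !rmorphM hC mpolyXE_id !rmorph_prod; congr (_ * _).
by apply: eq_bigr => i _; rewrite !rmorphXn hX.
Qed.

End PolynomialMorphism.

(** * The signed reversal matrix J *)

Section SignedReversal.
Variables (R : comPzRingType) (n m : nat).

Definition signed_rev : 'M[R]_n := tilde m 1%:M.

Lemma tildeE s (Y : 'M[R]_(n, s)) : tilde m Y = signed_rev *m Y.
Proof.
apply/matrixP => i j; rewrite !mxE -[Y in LHS]mul1mx !mxE.
by case: ifP => im; rewrite -?sumrN; apply: eq_bigr => l _;
  rewrite !mxE im ?mulNr.
Qed.

Hypothesis n_even : n = (2 * m)%N.

Lemma rev_ord_ltn_half (i : 'I_n) : (rev_ord i < m)%N = ~~ (i < m)%N.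
Proof. by have := ltn_ord i; rewrite /=; lia. Qed.

(** Reversal is an involution exchanging the two halves of the indices, so the entries at (i, j) and
    (j, i) carry opposite signs. *)
Lemma tr_signed_rev : signed_rev^T = - signed_rev.
Proof.
apply/matrixP => i j; rewrite !mxE.
have [<-|ij] := eqVneq (rev_ord j) i.
  by rewrite rev_ord_ltn_half rev_ordK eqxx; case: (j < m)%N; rewrite ?opprK.
have -> : (rev_ord i == j) = false.
  by apply: contra_neqF ij => /eqP <-; rewrite rev_ordK.
by rewrite !oppr0 !if_same oppr0.
Qed.

Lemma mul_tr_signed_rev : signed_rev^T *m signed_rev = 1%:M.
Proof.
rewrite tr_signed_rev mulNmx -tildeE; apply/matrixP => i j; rewrite !mxE.
by rewrite rev_ord_ltn_half rev_ordK; case: (i < m)%N; rewrite ?opprK.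
Qed.

Lemma mul_signed_rev_tr : signed_rev *m signed_rev^T = 1%:M.
Proof. by rewrite -mul_tr_signed_rev tr_signed_rev mulmxN mulNmx. Qed.

End SignedReversal.

Arguments signed_rev R n m : clear implicits.

Lemma map_signed_rev (R R' : comPzRingType) (f : {rmorphism R -> R'}) n m :
  map_mx f (signed_rev R n m) = signed_rev R' n m.
Proof.
by apply/matrixP => i j; rewrite !mxE; case: ifP => _; rewrite ?rmorphN rmorph_nat.
Qed.

(** * The matrices of t and of the alternating form *)

Section Coordinates.
Variables (F0 : fieldType) (v0 : discrete_valuation F0).
Variables (F : fieldExtType F0) (v : discrete_valuation F).
Hypothesis ramF : ramified_quadratic v0 v.
Variables (pi0 : valring v0) (pi : valring v).
Hypothesis pi_unif : uniformizer v (val pi).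
Hypothesis pi_sq : val pi ^+ 2 = (val pi0)%:A.
Variables (V : vectType F) (n m : nat) (e : n.-tuple V).

Lemma base_incl_pi_sq : base_incl ramF pi0 = pi ^+ 2.
Proof. by apply: val_inj; rewrite expr2 /= -pi_sq expr2. Qed.

Section Multiplication.
Hypothesis e_basis : basis_of {:V} e.

Lemma lcomb_delta (a : valring v0) j :
  lcomb m e pi (a *: delta_mx 0 j) = (val a)%:A *: fbasis m e pi j.
Proof.
rewrite /lcomb (bigD1 j)//= big1 ?addr0 => [|i ij].
  by rewrite !mxE !eqxx mulr1.
by rewrite !mxE (negPf ij) andbF mulr0 /= !scale0r.
Qed.

Lemma lcoord_lcomb c : lcoord v0 m e pi (lcomb m e pi c) = c.
Proof.
have lat : lattice m e pi (lcomb m e pi c).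
  exists (fun i => base_incl ramF (c 0 (lshift n i))
                   + base_incl ramF (c 0 (rshift n i)) * pi).
  by rewrite (lcombE pi_unif m e erefl).
have [c0 [_ c0_uniq]] :=
  (lattice_basisP ramF pi_unif m e_basis (erefl (val pi)) _).1 lat.
rewrite /lcoord; case: xgetP => [y _ /= /c0_uniq <-|/(_ c)/(_ erefl)//].
exact: c0_uniq.
Qed.

(** Multiplication by [pi] sends the i-th vector of the first half of [fbasis] to the i-th of the
    second half, and the latter to [pi ^+ 2 = pi0] times the former. *)
Lemma tmxE : tmx v0 m e pi = block_mx 0 1%:M pi0%:M 0.
Proof.
apply/row_matrixP => j; rewrite rowK -(splitK j); case: (split j) => i /=.
  rewrite -(fbasis_rshift pi_unif m e erefl) -[fbasis _ _ _ _]scale1r.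
  have -> : (1 : F) = (val (1 : valring v0))%:A by rewrite scale1r.
  rewrite -lcomb_delta lcoord_lcomb scale1r.
  by rewrite block_mxEv rowKu row_row_mx row0 row1 delta_mx_rshift.
rewrite (fbasis_rshift pi_unif m e erefl) scalerA -expr2 pi_sq.
rewrite -lcomb_delta lcoord_lcomb block_mxEv rowKd row_row_mx row0.
by rewrite delta_mx_lshift scale_row_mx scaler0 -scalemx1 linearZ /= row1.
Qed.

End Multiplication.

Section Form.
Variables (sigma : {rmorphism F -> F}) (phi : {hermitian V for false & sigma}).
Hypothesis sigma_F0 : forall a : F0, sigma a%:A = a%:A.
Hypothesis sigma_nontriv : exists x, sigma x != x.
Hypothesis F0_char : (2%:R : F0) != 0.
Hypothesis n_even : n = (2 * m)%N.
Hypothesis phi_split : forall i j : 'I_n,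
  phi (tnth e i) (tnth e (rev_ord j)) = (i == j)%:R.

(** Half the trace kills F0 times [pi] and is the identity on F0. Values of [phi] on two vectors of
    the same half of [fbasis] lie in F0 times [pi], hence the zero diagonal blocks; mixed values lie
    in F0 and give the entries of J up to sign. *)
Lemma gram_block :
  gram v0 m e pi phi = block_mx 0 (- signed_rev _ n m) (signed_rev _ n m) 0.
Proof.
have piN0 : val pi != 0 by case: pi_unif.
have pi0N0 : val pi0 != 0.
  by apply: contra_eq_neq pi_sq => ->; rewrite scale0r expf_neq0.
have piV : (val pi)^-1 = (val pi0)^-1%:A * val pi.
  apply: (mulfI piN0); rewrite divff// mulrCA -expr2 pi_sq -scalerAl mul1r.
  by rewrite scalerA mulVf ?scale1r.
have spi := conj_pi ramF pi_unif sigma_F0 sigma_nontriv pi_sq.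
pose c (i : 'I_n) := if (i < m)%N then (val pi)^-1 else 1.
have fl i : fbasis m e pi (lshift n i) = c i *: tnth e i.
  by rewrite /fbasis (unsplitK (inl i)) /c; case: ifP; rewrite ?scale1r.
have fr i : fbasis m e pi (rshift n i) = (val pi * c i) *: tnth e i.
  by rewrite (fbasis_rshift pi_unif m e erefl) fl scalerA.
have phiE a b i l : phi (a *: tnth e i) (b *: tnth e l)
    = a * sigma b * (rev_ord i == l)%:R.
  rewrite linearZl_LR linearZr_LR /= -[l]rev_ordK phi_split mulrA.
  by rewrite (can_eq (@rev_ordK n)).
(* When [rev_ord i = l], exactly one of [c i] and [c l] is the inverse of [pi]. If it is [c l], then
   [sigma] contributes a sign, which is the sign in J. *)
have cc i l : c i * sigma (c l) * (rev_ord i == l)%:R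
    = (signed_rev F0 n m i l)%:A * (val pi)^-1.
  rewrite !mxE; case: eqP => [<-|_]; last first.
    by rewrite !oppr0 !if_same scale0r mulr0 mul0r.
  rewrite /c rev_ord_ltn_half//; case: ifP => _ /=.
    by rewrite rmorph1 scale1r !mulr1 mul1r.
  by rewrite fmorphV spi invrN mul1r mulr1 scaleN1r mulN1r.
have valJ i l : val (signed_rev (valring v0) n m i l) = signed_rev F0 n m i l.
  by rewrite !mxE; case: ifP => _; rewrite ?rmorphN rmorph_nat.
have valJN i l : val ((- signed_rev (valring v0) n m) i l) = - signed_rev F0 n m i l.
  by rewrite -valJ mxE.
have ht := half_trace ramF pi_unif sigma_F0 sigma_nontriv pi_sq F0_char.
have ht_scal a : 2%:R^-1 * field_trace (a%:A : F) = a.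
  by rewrite -[X in _ = X](ht a 0) scale0r mul0r addr0.
have ht_pi a : 2%:R^-1 * field_trace (a%:A * val pi) = 0.
  by rewrite -[X in _ = X](ht 0 a) scale0r add0r.
apply/matrixP => j l; apply: val_inj.
rewrite (gramE ramF pi_unif sigma_F0 sigma_nontriv pi_sq F0_char n_even
  phi_split erefl) /trform.
rewrite -(splitK j) -(splitK l); case: (split j) => i; case: (split l) => i' /=;
  rewrite ?block_mxEul ?block_mxEur ?block_mxEdl ?block_mxEdr ?fl ?fr phiE
    ?rmorphM ?spi.
- rewrite cc piV mulrA -scalerAl mul1r scalerA ht_pi.
  by rewrite mxE.
- rewrite (mulrCA (c i)) -(mulrA (- _)) cc mulNr mulrCA divff// mulr1 -scaleNr.
  by rewrite ht_scal -valJN.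
- rewrite -(mulrA (val pi)) -(mulrA (val pi)) cc mulrCA divff// mulr1.
  by rewrite ht_scal -valJ.
- rewrite mulrACA -!mulrA (mulrA (c i)) cc mulNr (mulrCA (val pi)) divff// mulr1.
  by rewrite [val pi * _]mulrC -scaleNr ht_pi mxE.
Qed.

End Form.
End Coordinates.

(** * Matrix equations equivalent to the conditions on the chart *)

Section ChartMatrices.
Variables (R : comPzRingType) (p : R) (n m s : nat) (idx : 'I_s -> 'I_n).
Hypothesis n_even : n = (2 * m)%N.
Implicit Types (X : 'M[R]_n) (Y : 'M[R]_(n, s)) (D : 'M[R]_s).
Local Notation J := (signed_rev R n m).

(** These are the generators of the ideal I evaluated at matrices over [R], where [p] stands for the
    image of [pi]. *)
Record chart_eqs Y D : Prop := {
  ce_normal : rowsub idx Y = 1%:M;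
  ce_alt : D + D^T = 0;
  ce_quad : D *m ((tilde m Y)^T *m Y) + (2%:R * p)%:M = 0 }.

Definition chart_mx Y D : 'M[R]_n := tilde m Y *m D *m Y^T - p%:M.

(** Up to the scalar part, which commutes with J, both sides equal J Y D Y^t J: the signs from D^t =
    - D and J^t = - J cancel. This identity is the isotropy of the graph of [chart_mx]. *)
Lemma chart_mx_isotropic Y D : D + D^T = 0 ->
  J *m (chart_mx Y D)^T = chart_mx Y D *m J.
Proof.
move=> /eqP; rewrite addr_eq0 => /eqP DE; have DT : D^T = - D by rewrite {2}DE opprK.
rewrite /chart_mx linearB /= tr_scalar_mx !trmx_mul trmxK tildeE trmx_mul.
rewrite tr_signed_rev// DT mulmxBr mulmxBl scalar_mxC; congr (_ - _).
by rewrite !(mulmxN, mulNmx) opprK !mulmxA.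
Qed.

(** Transposing the quadratic relation and using D^t = - D gives Y^t (tilde Y) D = 2p, so Y^t X = 2p
    Y^t - p Y^t. This expresses the inclusion of F_0 in F_1. *)
Lemma chart_mx_eigen Y D : chart_eqs Y D -> Y^T *m chart_mx Y D = p *: Y^T.
Proof.
case=> _ /eqP; rewrite addr_eq0 => /eqP DE.
have DT : D^T = - D by rewrite {2}DE opprK.
move=> /(congr1 trmx); rewrite linearD /= tr_scalar_mx !trmx_mul trmxK DT trmx0.
rewrite mulmxN => /eqP; rewrite addrC subr_eq0 => /eqP YD.
rewrite /chart_mx mulmxBr !mulmxA -YD mul_scalar_mx mul_mx_scalar.
by rewrite -scalerBl mulr_natl mulr2n addrK.
Qed.

(** The last three hypotheses encode, in this order, the inclusion of F_0 in F_1, the isotropy of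
    F_1, and the inclusion of (t + pi) F_1 in F_0. All cancellations use that Y has a left
    inverse. *)
Lemma chart_mxP X Y : rowsub idx Y = 1%:M -> Y^T *m X = p *: Y^T ->
    J *m X^T = X *m J -> X + p%:M = colsub idx (X + p%:M) *m Y^T ->
  exists2 D, chart_eqs Y D & X = chart_mx Y D.
Proof.
set A := colsub idx _ => Y1 eigX isoX XE.
(* [E] selects the rows [idx], so the normalisation of Y makes it a left inverse of Y. *)
pose E : 'M[R]_(s, n) := rowsub idx 1%:M.
have EY : E *m Y = 1%:M by rewrite mul_rowsub_mx mul1mx.
have YE : Y^T *m E^T = 1%:M by rewrite -trmx_mul EY trmx1.
have XA : X = A *m Y^T - p%:M by rewrite -XE addrK.
have isoA : A *m Y^T *m J = J *m Y *m A^T.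
  move: isoX; rewrite XA linearB /= tr_scalar_mx trmx_mul trmxK mulmxBr mulmxBl.
  by rewrite scalar_mxC mulmxA => /addIr ->.
have [D AE] : exists D, A = tilde m Y *m D.
  (* Since Y^t E^t = 1 and J J^t = 1, A = (A Y^t J) J^t E^t; by [isoA] this is J Y (A^t J^t E^t),
     which exhibits D. *)
  exists (A^T *m J^T *m E^T); rewrite tildeE !mulmxA -isoA -(mulmxA _ J).
  rewrite mul_signed_rev_tr// mulmx1.
  by rewrite -mulmxA YE mulmx1.
exists D; last by rewrite /chart_mx -AE.
have alt : D + D^T = 0.
  (* Multiplying [isoA] by J^t on both sides turns its two terms into Y D Y^t and - Y D^t Y^t,
     because (J^t)^2 = - 1. The factors Y and Y^t are then cancelled by E and E^t. *)
  have: Y *m (D + D^T) *m Y^T = 0.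
    have: J^T *m (A *m Y^T *m J - J *m Y *m A^T) *m J^T = 0.
      by rewrite isoA subrr mulmx0 mul0mx.
    rewrite AE tildeE trmx_mul trmx_mul mulmxBr mulmxBl !mulmxA.
    rewrite mul_tr_signed_rev// mul1mx -!(mulmxA _ J J^T) mul_signed_rev_tr//.
    rewrite mulmx1 -(mulmxA _ J^T J^T).
    have -> : J^T *m J^T = - 1%:M.
      by rewrite [in X in X *m _]tr_signed_rev// mulNmx mul_signed_rev_tr.
    by rewrite mulmxN mulmx1 opprK mulmxDr mulmxDl.
  move=> /(congr1 (fun M => E *m M *m E^T)); rewrite mulmx0 mul0mx.
  by rewrite !mulmxA EY mul1mx -mulmxA YE mulmx1.
split=> //.
have : Y^T *m A = (2%:R * p)%:M.
  move: eigX; rewrite XA mulmxBr mul_mx_scalar => /eqP.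
  rewrite subr_eq -scalerDl -mulr2n -(mulr_natl p) => /eqP.
  move=> /(congr1 (mulmx^~ E^T)); rewrite -!mulmxA YE mulmx1 -scalemxAl YE.
  by rewrite scalemx1.
(* Transposition gives 2p = D^t Q, so the quadratic relation becomes (D + D^t) Q = 0. *)
move=> /(congr1 trmx); rewrite AE tr_scalar_mx !trmx_mul trmxK => <-.
by rewrite -mulmxA -mulmxDl alt mul0mx.
Qed.

(** D is recovered from (tilde Y) D Y^t by multiplying with E J^t on the left and E^t on the
    right. *)
Lemma chart_mx_inj Y D D' : rowsub idx Y = 1%:M ->
  chart_mx Y D = chart_mx Y D' -> D = D'.
Proof.
move=> Y1 /addIr; pose E : 'M[R]_(s, n) := rowsub idx 1%:M.
have EY : E *m Y = 1%:M by rewrite mul_rowsub_mx mul1mx.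
have YE : Y^T *m E^T = 1%:M by rewrite -trmx_mul EY trmx1.
have retract C : E *m J^T *m (tilde m Y *m C *m Y^T) *m E^T = C.
  rewrite tildeE !mulmxA -(mulmxA E) mul_tr_signed_rev// mulmx1 EY mul1mx.
  by rewrite -mulmxA YE mulmx1.
by move=> DD'; rewrite -[D]retract DD' retract.
Qed.

Definition chart_pair Y D : set 'rV[R]_(n + n) * set 'rV[R]_(n + n) :=
  (rowspace (row_mx (p *: Y^T) Y^T), rowspace (row_mx (chart_mx Y D) 1%:M)).

Lemma colsub_chart0 Y : rowsub idx Y = 1%:M ->
  colsub (fun k => rshift n (idx k)) (row_mx (p *: Y^T) Y^T) = 1%:M.
Proof.
move=> Y1; apply/matrixP => i j; rewrite mxE row_mxEr mxE.
by move/matrixP/(_ j i): Y1; rewrite !mxE eq_sym.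
Qed.

Lemma colsub_chart1 X : colsub (@rshift n n) (row_mx X 1%:M) = 1%:M.
Proof. by apply/matrixP => i j; rewrite mxE row_mxEr. Qed.

Lemma chart_pair_inj Y Y' D D' :
  rowsub idx Y = 1%:M -> rowsub idx Y' = 1%:M ->
  chart_pair Y D = chart_pair Y' D' -> Y = Y' /\ D = D'.
Proof.
move=> Y1 Y1' [F0E F1E].
have /eq_row_mx[_ /trmx_inj YY'] :=
  rowspace_colsub_inj (colsub_chart0 Y1) (colsub_chart0 Y1') F0E.
have /eq_row_mx[XX' _] :=
  rowspace_colsub_inj (colsub_chart1 _) (colsub_chart1 _) F1E.
by split=> //; apply: chart_mx_inj Y1 _; rewrite XX' YY'.
Qed.

End ChartMatrices.

(** * Points of the chart over an arbitrary O_F-algebra *)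

Section ChartPoints.
Variables (F0 : fieldType) (v0 : discrete_valuation F0).
Variables (F : fieldExtType F0) (v : discrete_valuation F).
Hypothesis ramF : ramified_quadratic v0 v.
Variables (pi0 : valring v0) (pi : valring v).
Hypothesis pi_unif : uniformizer v (val pi).
Hypothesis pi_sq : val pi ^+ 2 = (val pi0)%:A.
Variables (V : vectType F) (n m s : nat) (e : n.-tuple V).
Hypothesis e_basis : basis_of {:V} e.
Variables (sigma : {rmorphism F -> F}) (phi : {hermitian V for false & sigma}).
Hypothesis sigma_F0 : forall a : F0, sigma a%:A = a%:A.
Hypothesis sigma_nontriv : exists x, sigma x != x.
Hypothesis F0_char : (2%:R : F0) != 0.
Hypothesis n_even : n = (2 * m)%N.
Hypothesis phi_split : forall i j : 'I_n,
  phi (tnth e i) (tnth e (rev_ord j)) = (i == j)%:R.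
Variables (R : comPzRingType) (rho : {rmorphism valring v -> R}).
Variable idx : 'I_s -> 'I_n.
Local Notation J := (signed_rev R n m).

Lemma tR_row_mx (x y : 'rV_n) :
  tR ramF m e pi rho (row_mx x y) = row_mx (rho pi ^+ 2 *: y) x.
Proof.
pose rho0 : {rmorphism valring v0 -> R} := rho \o base_incl ramF.
rewrite /tR (tmxE ramF pi_unif pi_sq m e_basis) -/(rho0 : _ -> _).
rewrite (map_block_mx rho0) !map_mx0 map_mx1 map_scalar_mx mul_row_block.
rewrite !mulmx0 mulmx1 addr0 add0r mul_mx_scalar /= (base_incl_pi_sq ramF pi_sq).
by rewrite rmorphXn.
Qed.

Lemma trformR_row_mx (x y x' y' : 'rV_n) :
  trformR ramF m e pi phi rho (row_mx x y) (row_mx x' y') =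
  (y *m J *m x'^T - x *m J *m y'^T) 0 0.
Proof.
pose rho0 : {rmorphism valring v0 -> R} := rho \o base_incl ramF.
rewrite /trformR (gram_block ramF pi_unif pi_sq sigma_F0 sigma_nontriv F0_char
  n_even phi_split).
rewrite (map_block_mx rho0) map_mxN !map_mx0 map_signed_rev mul_row_block.
rewrite !mulmx0 add0r addr0 tr_row_mx mul_row_col mulmxN mulNmx.
by [].
Qed.

Lemma trformR_graph X (x y w : 'rV_n) :
  trformR ramF m e pi phi rho (row_mx x y) (w *m row_mx X 1%:M) =
  ((y *m J *m X^T - x *m J) *m w^T) 0 0.
Proof.
by rewrite mul_mx_row mulmx1 trformR_row_mx trmx_mul mulmxBl !mulmxA.
Qed.

(** The pairing with the graph vector over w is linear in w, so testing on unit vectors suffices.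
    When J X^t = X J, the equation reads y X J = x J, that is x = y X, and the orthogonal is the
    graph itself. *)
Lemma perp_graph X (x y : 'rV_n) :
  perp ramF m e pi phi rho (rowspace (row_mx X 1%:M)) (row_mx x y) <->
  y *m J *m X^T = x *m J.
Proof.
split=> [xy|xy _ [w ->]]; last by rewrite trformR_graph xy subrr mul0mx mxE.
apply/eqP; rewrite -subr_eq0; apply/eqP/rowP => j.
have /xy : rowspace (row_mx X 1%:M) (delta_mx 0 j *m row_mx X 1%:M) by exact: rowspace_mul.
by rewrite trformR_graph trmx_delta -colE !mxE.
Qed.

Lemma rsubmx_colsub : rsubmx =1 colsub (@rshift n n) :> ('rV[R]_(n + n) -> 'rV_n).
Proof. by move=> x; rewrite rsubmxEsub. Qed.

Lemma coords_colsub : (fun x : 'rV[R]_(n + n) => \row_k x 0 (rshift n (idx k)))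
  =1 colsub (fun k => rshift n (idx k)).
Proof. by move=> x; apply/rowP => k; rewrite !mxE. Qed.

Lemma chart_pair_point Y D : chart_eqs (rho pi) m idx Y D ->
  chart_point ramF m e pi phi rho idx (chart_pair (rho pi) m Y D).
Proof.
move=> YD; have Y1 := ce_normal YD.
have iso := chart_mx_isotropic (rho pi) n_even Y (ce_alt YD).
have eig := chart_mx_eigen YD.
split=> /=; last 2 first.
- exact: rowspace_uniq_lift rsubmx_colsub (colsub_chart1 _).
- exact: rowspace_uniq_lift coords_colsub (colsub_chart0 _ Y1).
split.
- exact: rowspace_locally_direct_summand (colsub_chart0 _ Y1).
- exact: rowspace_locally_direct_summand (colsub_chart1 _).
- move=> _ [c ->]; exists (c *m Y^T).
  by rewrite -[RHS]mulmxA [X in _ = _ *m X]mul_mx_row mulmx1 eig.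
- apply/seteqP; split=> x; rewrite -(hsubmxK x); last first.
    move=> [c]; rewrite mul_mx_row mulmx1 => ->; apply/perp_graph.
    by rewrite -!mulmxA iso.
  move/perp_graph; rewrite -mulmxA iso mulmxA => xE; exists (rsubmx x).
  rewrite mul_mx_row mulmx1; congr row_mx.
  move/(congr1 (mulmx^~ J^T)): xE.
  by rewrite -!mulmxA mul_signed_rev_tr// !mulmx1.
(* For the graph vector (c X, c), the sum of its image under t and its multiple by pi is (pi u, u),
   where u = c (X + pi) = c (tilde Y) D Y^t. *)
- move=> _ [c ->]; exists (c *m tilde m Y *m D).
  rewrite !mul_mx_row mulmx1 tR_row_mx scale_row_mx add_row_mx -scalemxAr.
  have <- : c *m chart_mx (rho pi) m Y D + rho pi *: c = c *m tilde m Y *m D *m Y^T.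
    by rewrite -mul_mx_scalar -mulmxDr subrK !mulmxA.
  by rewrite scalerDr scalerA -expr2 [_ *: c + _]addrC.
- move=> _ [c ->]; rewrite mul_mx_row tR_row_mx scale_row_mx opp_row_mx add_row_mx.
  by rewrite -!scalemxAr scalerA -expr2 !subrr row_mx0.
Qed.

(** The two projections of the chart provide normalised bases [B1] of F_1 and [B0] of F_0; the
    remaining conditions on the point are then read row by row on these bases. *)
Lemma chart_pointP q : chart_point ramF m e pi phi rho idx q ->
  exists Y D, chart_eqs (rho pi) m idx Y D /\ q = chart_pair (rho pi) m Y D.
Proof.
case: q => q0 q1 [/= [[sub0 _] [sub1 _] q01 q1perp q1D q0B] lift1 lift0].
have [B1 B1r q1E] := uniq_lift_rowspace rsubmx_colsub sub1 lift1.
have [B0 B0r q0E] := uniq_lift_rowspace coords_colsub sub0 lift0.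
pose X := lsubmx B1; pose Y := (rsubmx B0)^T.
have B1E : B1 = row_mx X 1%:M by rewrite -B1r -rsubmxEsub hsubmxK.
(* On (u, w), the second component of (t - pi)(u, w) = 0 is u = pi w. *)
have B0E : B0 = row_mx (rho pi *: Y^T) Y^T.
  rewrite -[LHS]hsubmxK trmxK; congr row_mx; apply/row_matrixP => i.
  have : q0 (row i (row_mx (lsubmx B0) (rsubmx B0))).
    by rewrite hsubmxK q0E; exact: rowspace_row.
  move=> /q0B; rewrite row_row_mx tR_row_mx scale_row_mx opp_row_mx add_row_mx.
  rewrite -(row_mx0 R) => /eq_row_mx[_ /eqP].
  rewrite subr_eq0 => /eqP ->.
  by rewrite linearZ.
have Y1 : rowsub idx Y = 1%:M.
  apply/matrixP => i j; move/matrixP/(_ j i): B0r.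
  by rewrite !mxE eq_sym.
have eig : Y^T *m X = rho pi *: Y^T.
  apply/row_matrixP => i.
  have := q01 (row i B0); rewrite q0E q1E => /(_ (rowspace_row _ i)) [c].
  rewrite B0E B1E row_row_mx mul_mx_row mulmx1 => /eq_row_mx[-> <-].
  by rewrite row_mul.
have iso : J *m X^T = X *m J.
  apply/row_matrixP => i.
  have := rowspace_row B1 i; rewrite -q1E -q1perp q1E B1E row_row_mx.
  by move=> /perp_graph; rewrite -!row_mul mul1mx.
(* The second half of (t + pi) applied to row i of (X, 1) is row i of X + pi. Its entries at [idx]
   are the coefficients on the basis [B0] of F_0. *)
have XE : X + (rho pi)%:M = colsub idx (X + (rho pi)%:M) *m Y^T.
  apply/row_matrixP => i.
  have := q1D (row i B1); rewrite q0E q1E => /(_ (rowspace_row _ i)).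
  move=> /(mem_rowspace_colsub B0r).
  rewrite B0E B1E row_row_mx tR_row_mx scale_row_mx add_row_mx -(scalemx1 _ (rho pi)).
  rewrite mul_mx_row => /eq_row_mx[_].
  rewrite -linearZ -linearD /= => ->; rewrite row_mul; congr (_ *m _).
  by apply/rowP => k; rewrite mxE row_mxEr !mxE.
have [D YD XYD] := chart_mxP n_even Y1 eig iso XE.
by exists Y, D; split=> //; rewrite /chart_pair -XYD -B1E -B0E q0E q1E.
Qed.

End ChartPoints.

(** * Base change of the pairs, and algebra homomorphisms out of the chart ring *)

Lemma map_tilde (R R' : comPzRingType) (g : {rmorphism R -> R'}) n m s
    (Y : 'M[R]_(n, s)) : map_mx g (tilde m Y) = tilde m (map_mx g Y).
Proof. by apply/matrixP => i j; rewrite !mxE; case: ifP; rewrite ?rmorphN. Qed.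

Lemma base_change_chart_pair (R R' : comPzRingType) (g : {rmorphism R -> R'})
    p n m s (Y : 'M[R]_(n, s)) D :
  pair_base_change g (chart_pair p m Y D)
    = chart_pair (g p) m (map_mx g Y) (map_mx g D).
Proof.
rewrite /pair_base_change /= !base_change_rowspace !map_row_mx map_mx1 map_mxB.
by rewrite !map_mxM map_tilde map_scalar_mx map_mxZ -!map_trmx.
Qed.

Section ChartRingMorphisms.
Variables (O : comNzRingType) (pi : O) (n m s : nat) (idx : 'I_s -> 'I_n).
Variables (R : comPzRingType) (rho : {rmorphism O -> R}).
Local Notation DY := (DYring O n s).

Lemma mx_entries_ker (w : {rmorphism DY -> R}) a b (A : 'M[DY]_(a, b)) :
  (forall x, mx_entries A x -> w x = 0) <-> map_mx w A = 0.
Proof.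
split=> [wA|wA _ [i [j ->]]].
  by apply/matrixP => i j; rewrite !mxE; apply: wA; exists i, j.
by move/matrixP/(_ i j): wA; rewrite !mxE.
Qed.

Lemma chart_relations_ker (w : {rmorphism DY -> R}) :
    (forall c, w c%:MP = rho c) ->
  (forall x, chart_relations pi m idx x -> w x = 0) <->
  chart_eqs (rho pi) m idx (map_mx w (Ymx O n s)) (map_mx w (Dmx O n s)).
Proof.
move=> wC.
have normalE : map_mx w (rowsub idx (Ymx O n s) - 1%:M)
    = rowsub idx (map_mx w (Ymx O n s)) - 1%:M.
  by rewrite map_mxB map_mx1 map_mxsub.
have altE : map_mx w (Dmx O n s + (Dmx O n s)^T)
    = map_mx w (Dmx O n s) + (map_mx w (Dmx O n s))^T.
  by rewrite map_mxD -map_trmx.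
have quadE : map_mx w (Dmx O n s *m Qmx O n m s + (2%:R * pi)%:MP%:M)
    = map_mx w (Dmx O n s) *m ((tilde m (map_mx w (Ymx O n s)))^T
        *m map_mx w (Ymx O n s)) + (2%:R * rho pi)%:M.
  by rewrite map_mxD !map_mxM -map_tilde !map_trmx map_scalar_mx wC rmorphM rmorph_nat.
split=> [w0|[Y1 DA DQ] x].
  split.
  - apply/eqP; rewrite -subr_eq0 -normalE; apply/eqP/mx_entries_ker => x xA.
    by apply: w0; left; left.
  - by rewrite -altE; apply/mx_entries_ker => x xA; apply: w0; left; right.
  - by rewrite -quadE; apply/mx_entries_ker => x xA; apply: w0; right.
case=> [[]|].
- by move: x; apply/mx_entries_ker; rewrite normalE Y1 subrr.
- by move: x; apply/mx_entries_ker; rewrite altE.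
- by move: x; apply/mx_entries_ker; rewrite quadE.
Qed.

Local Notation str := (chart_ring_str pi m idx).

(** Pulling [h] back to the polynomial ring lets it be tested on indeterminates; the images of the
    generic Y and D are the coordinates of the point given by [h]. *)
Definition DYeval (h : alg_hom str rho) : {rmorphism DY -> R} :=
  h \o gq_proj (chart_relations pi m idx).

Lemma DYeval_eqs (h : alg_hom str rho) :
  chart_eqs (rho pi) m idx (map_mx (DYeval h) (Ymx O n s))
    (map_mx (DYeval h) (Dmx O n s)).
Proof.
apply/chart_relations_ker => [c|x xG]; first exact: (ahomE h c).
rewrite /= -(rmorph0 h) -(rmorph0 (gq_proj (chart_relations pi m idx))).
congr (h _); apply/gq_projP; rewrite subr0; apply/asboolP.
by exists 1%N, (fun=> 1), (fun=> x); rewrite big_ord1 mul1r.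
Qed.

Lemma alg_hom_ext (h h' : alg_hom str rho) :
  map_mx (DYeval h) (Ymx O n s) = map_mx (DYeval h') (Ymx O n s) ->
  map_mx (DYeval h) (Dmx O n s) = map_mx (DYeval h') (Dmx O n s) -> h =1 h'.
Proof.
move=> YY' DD' x; have [y ->] := gq_proj_surj x.
suff /(_ y) : DYeval h =1 DYeval h' by [].
apply: mpoly_rmorphism_ext => [c|i].
  exact: etrans (ahomE h c) (esym (ahomE h' c)).
rewrite -(splitK i); case: (split i) => k; case/mxvec_indexP: k => a b.
  by move/matrixP/(_ a b): DD'; rewrite !mxE.
by move/matrixP/(_ a b): YY'; rewrite !mxE.
Qed.

(** Evaluation of the indeterminates at the entries of D and Y kills the relations, hence descends
    to the quotient. *)
Lemma alg_hom_of_eqs Y D : chart_eqs (rho pi) m idx Y D ->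
  exists h : alg_hom str rho, map_mx (DYeval h) (Ymx O n s) = Y
    /\ map_mx (DYeval h) (Dmx O n s) = D.
Proof.
move=> YD.
have [w [wC wX]] := mpoly_eval rho (fun i : 'I_(s * s + n * s) =>
  match split i with inl k => mxvec D 0 k | inr k => mxvec Y 0 k end).
have wY : map_mx w (Ymx O n s) = Y.
  by apply/matrixP => i j; rewrite !mxE wX (unsplitK (inr _)) mxvecE.
have wD : map_mx w (Dmx O n s) = D.
  by apply/matrixP => i j; rewrite !mxE wX (unsplitK (inl _)) mxvecE.
have w0 : forall x, chart_relations pi m idx x -> w x = 0.
  by apply/chart_relations_ker => //; rewrite wY wD.
have [h hE] := gq_lift w0.
have hC c : h (str c) = rho c by rewrite hE wC.
exists (AlgHom hC); split; [rewrite -[RHS]wY|rewrite -[RHS]wD];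
  by apply/matrixP => i j; rewrite !mxE /= hE.
Qed.

End ChartRingMorphisms.

Theorem theorem4p2
    (F0 : fieldType) (v0 : discrete_valuation F0)
    (k : fieldType) (res : {rmorphism valring v0 -> k})
    (F : fieldExtType F0) (v : discrete_valuation F)
    (pi0 : valring v0) (pi : valring v) (sigma : {rmorphism F -> F})
    (n m r s : nat) (V : vectType F) (phi : {hermitian V for false & sigma})
    (e : n.-tuple V)
    (v0_complete : complete_valuation v0)
    (res_residue : residue_map res) (k_perfect : perfect_field k)
    (k_char : (2%:R : k) != 0)
    (ramF : ramified_quadratic v0 v)
    (pi0_unif : uniformizer v0 (val pi0)) (pi_unif : uniformizer v (val pi))
    (pi_sq : val pi ^+ 2 = (val pi0)%:A)
    (sigma_F0 : forall a : F0, sigma a%:A = a%:A)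
    (sigma_nontriv : exists x, sigma x != x)
    (n_even : n = (2 * m)%N) (n_gt3 : (3 < n)%N)
    (e_basis : basis_of {:V} e)
    (phi_split : forall i j : 'I_n,
       phi (tnth e i) (tnth e (rev_ord j)) = (i == j)%:R)
    (signature : (r + s)%N = n) (s_le_r : (s <= r)%N) :
  exists2 idx : 'I_s -> 'I_n, injective idx &
    iso_Spec (chart_ring_str pi m idx)
      (fun R => set 'rV[R]_(n + n) * set 'rV[R]_(n + n))%type
      (@pair_base_change (n + n))
      (fun R rho p => chart_point ramF m e pi phi rho idx p).
Proof.
have F0_char : (2%:R : F0) != 0.
  (* If 2 vanished in F0 it would vanish in the subring [valring v0], and then in k by applying
     [res]. *)
  apply: contra_neq k_char => F2; rewrite -(rmorph_nat res).
  have -> : (2%:R : valring v0) = 0 by apply: val_inj; rewrite rmorph_nat.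
  exact: rmorph0.
have s_le_n : (s <= n)%N by lia.
exists (widen_ord s_le_n); first by move=> i j [] /val_inj.
pose idx := widen_ord s_le_n.
(* A homomorphism h is sent to the pair built from the images under h of the generic matrices Y and
   D. The four goals are membership in the chart, injectivity, surjectivity and naturality in R. *)
exists (fun (R : comPzRingType) (rho : {rmorphism valring v -> R})
    (h : alg_hom (chart_ring_str pi m idx) rho) => chart_pair (rho pi) m
  (map_mx (DYeval h) (Ymx _ n s)) (map_mx (DYeval h) (Dmx _ n s))).
split.
- move=> R rho h.
  exact: (chart_pair_point ramF pi_unif pi_sq e_basis sigma_F0 sigma_nontriv
    F0_char n_even phi_split (DYeval_eqs h)).
- move=> R rho h h' /(chart_pair_inj n_even (ce_normal (DYeval_eqs h))
    (ce_normal (DYeval_eqs h'))) [].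
  exact: alg_hom_ext.
- move=> R rho q /(chart_pointP pi_unif pi_sq e_basis sigma_F0
    sigma_nontriv F0_char n_even phi_split) [Y [D [/alg_hom_of_eqs[h [hY hD]] ->]]].
  by exists h; rewrite hY hD.
- move=> R R' rho rho' g h h' gE hE.
  rewrite base_change_chart_pair -!map_mx_comp -gE.
  congr chart_pair; apply/matrixP => i j; rewrite !mxE; exact: hE.
Qed.
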